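(* Let $X$ be a median pretree whose shadow topology $\tau_s$ is compact or Polish. Then every function $f\colon X\to\mathbb{R}$ of bounded variation (that is, every bounded $f$ with $\Upsilon(f)<\infty$) has the point of continuity property with respect to $\tau_s$. If moreover $(X,\tau_s)$ is Polish, then $f$ is a Baire 1 function.
   Context: Pretree: a pair $(X,R)$ with $X$ a set and $R$ a ternary relation on $X$ (write $\langle a,b,c\rangle$ for $(a,b,c)\in R$) such that for all $a,b,c,d\in X$: (B1) $\langle a,b,c\rangle\Rightarrow\langle c,b,a\rangle$; (B2) $\langle a,b,c\rangle\wedge\langle a,c,b\rangle\Leftrightarrow b=c$; (B3) $\langle a,b,c\rangle\Rightarrow\langle a,b,d\rangle\vee\langle d,b,c\rangle$. Intervals: $[u,v]:=\{x\in X:\langle u,x,v\rangle\}$. Median pretree: a pretree such that $[a,b]\cap[a,c]\cap[b,c]$ is nonempty for all $a,b,c\in X$; this intersection is then a singleton, whose element is denoted $m(a,b,c)$. (Dendrons with their standard betweenness relation, and linearly ordered sets, are examples.) A subset $Y\subseteq X$ is a subalgebra if $m(a,b,c)\in Y$ for all $a,b,c\in Y$. Shadow topology $\tau_s$ on a pretree $X$: the topology having as a subbase of open sets all branches $\{x\in X: u\notin[x,v]\}$, where $u,v\in X$, $u\neq v$. Adjacent doublets: for $Y\subseteq X$, $adj(Y)$ is the set of all two-element subsets $\{a,b\}\subseteq Y$ with $[a,b]\cap Y=\{a,b\}$. Variation: for a bounded function $f\colon X\to\mathbb{R}$ and a finite subalgebra $\sigma\subseteq X$, put $\Upsilon(f,\sigma):=\sum_{\{a,b\}\in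 adj(\sigma)}|f(a)-f(b)|$, and $\Upsilon(f):=\sup\{\Upsilon(f,\sigma):\sigma \text{ a finite subalgebra of } X\}$. The function $f$ has bounded variation if $\Upsilon(f)<\infty$. Point of continuity property for $f\colon X\to\mathbb{R}$ on a topological space $X$: for every nonempty closed $A\subseteq X$ the restriction $f|_A\colon A\to\mathbb{R}$ has a point of continuity. A topological space is Polish if it is homeomorphic to a separable complete metric space. A Baire 1 function is a pointwise limit of a sequence of continuous real-valued functions. *)

(* Defs.v *)
From HB Require Import structures.
From mathcomp Require Import all_boot all_order all_algebra.
From mathcomp Require Import all_classical reals ereal.
From mathcomp Require Import topology metric_structure normedtype.

Set Implicit Arguments.
Unset Strict Implicit.
Unset Printing Implicit Defensive.

Import Order.TTheory GRing.Theory Num.Theory.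
Import numFieldNormedType.Exports.

Local Open Scope classical_set_scope.
Local Open Scope ring_scope.

HB.mixin Record isPretree X := {
  btw : X -> X -> X -> Prop;
  btw_sym : forall a b c, btw a b c -> btw c b a;
  btw_antisym : forall a b c, btw a b c /\ btw a c b <-> b = c;
  btw_split : forall a b c d, btw a b c -> btw a b d \/ btw d b c
}.

#[short(type="pretreeType")]
HB.structure Definition Pretree := {X of isPretree X & Choice X}.

Definition segment (X : pretreeType) (u v : X) : set X := [set x | btw u x v].

HB.mixin Record Pretree_isMedian X & Pretree X := {
  segment_meet : forall a b c : X,
    segment a b `&` segment a c `&` segment b c !=set0
}.

#[short(type="medianPretreeType")]
HB.structure Definition MedianPretree := {X of Pretree X & Pretree_isMedian X}.

(* The default value [a] is never used: see [medianP] and [median_unique]. *)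
Definition median (X : medianPretreeType) (a b c : X) : X :=
  xget a (segment a b `&` segment a c `&` segment b c).

Lemma medianP (X : medianPretreeType) (a b c : X) :
  (segment a b `&` segment a c `&` segment b c) (median a b c).
Proof. by apply: xgetPex; exact: segment_meet. Qed.

Lemma median_unique (X : medianPretreeType) (a b c x : X) :
  (segment a b `&` segment a c `&` segment b c) x -> x = median a b c.
Proof.
move=> [[xab xac] xbc]; have [[]] := medianP a b c.
move: (median a b c) => y yab yac ybc.
have E (d : X) : btw d x y -> btw d y x -> x = y.
  by move=> dxy dyx; apply/(btw_antisym d).
have xP : forall z t u : X, btw z t u -> forall w, btw z t w \/ btw u t w.
  by move=> z t u ztu w; case: (btw_split _ _ _ w ztu) => [|/(btw_sym _ _ _)]; [left|right].
have := xP _ _ _ xab y; have := xP _ _ _ xac y; have := xP _ _ _ xbc y.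
have := xP _ _ _ yab x; have := xP _ _ _ yac x; have := xP _ _ _ ybc x.
have := @E a; have := @E b; have := @E c; tauto.
Qed.

Definition subalgebra (X : medianPretreeType) (Y : set X) : Prop :=
  forall a b c, Y a -> Y b -> Y c -> Y (median a b c).

Definition branch (X : pretreeType) (u v : X) : set X :=
  [set x | ~ segment x v u].

Definition branches (X : pretreeType) : set (set X) :=
  [set B | exists u v : X, u <> v /\ B = branch u v].

(* Alias of [X] whose canonical topology is the shadow topology. *)
Definition shadow (X : pretreeType) : Type := X.

HB.instance Definition _ (X : pretreeType) := Choice.on (shadow X).
HB.instance Definition _ (X : pretreeType) :=
  isSubBaseTopological.Build (shadow X) (@branches X) id.

Lemma shadow_openE (X : pretreeType) (A : set (shadow X)) :
  open A <-> exists2 C, C `<=` finI_from (@branches X) id &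
                        \bigcup_(B in C) B = A.
Proof. by split=> -[C]; exists C. Qed.

Definition adj (X : pretreeType) (Y : set X) : set (set X) :=
  [set e | exists a b : X, [/\ a <> b, e = [set a; b], e `<=` Y &
                               segment a b `&` Y = e]].

Section Variation.
Context {R : realType} {X : medianPretreeType}.
Implicit Types (f : X -> R) (s : set X).

(* For a doublet [e = {a, b}] this is [`|f a - f b|]: see [jump2]. *)
Definition jump f (e : set X) : R :=
  xget 0 [set r | exists a b, e = [set a; b] /\ r = `|f a - f b|].

Lemma jump2 f (a b : X) : jump f [set a; b] = `|f a - f b|.
Proof.
apply: xget_unique; first by exists a, b.
move=> _ [c [d [/seteqP[abcd cdab] ->]]].
have := cdab c (or_introl erefl); have := cdab d (or_intror erefl).
have := abcd a (or_introl erefl); have := abcd b (or_intror erefl).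
by do 4![case=> /= ?]; subst; rewrite ?subrr// distrC.
Qed.

Definition Upsilon_on f s : R := \sum_(e \in adj s) jump f e.

Definition Upsilon f : \bar R :=
  ereal_sup [set (Upsilon_on f s)%:E |
    s in [set s | finite_set s /\ subalgebra s]].

Definition has_bounded_variation f : Prop :=
  bounded_fun f /\ (Upsilon f < +oo)%E.

End Variation.

Definition point_of_continuity_property (R : realType) (T : topologicalType)
    (f : T -> R) : Prop :=
  forall A : set T, A !=set0 -> closed A ->
    exists2 x, A x & {for x, continuous (f : subspace A -> R)}.

Definition Baire1 (R : realType) (T : topologicalType) (f : T -> R) : Prop :=
  exists g : nat -> T -> R,
    (forall n, continuous (g n)) /\ (forall x, g n x @[n --> \oo] --> f x).

Definition homeomorphic (S T : topologicalType) : Prop :=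
  exists (h : S -> T) (k : T -> S),
    [/\ cancel h k, cancel k h, continuous h & continuous k].

Definition separable_space (T : topologicalType) : Prop :=
  exists2 D : set T, countable D & dense D.

(* Completeness is phrased as in [completeType], which is not used because it
   would exclude the empty space. *)
Definition complete_metric (R : realType) (M : metricType R) : Prop :=
  forall F : set_system M, ProperFilter F -> cauchy F ->
    exists l : M, F --> l.

Definition polish (R : realType) (T : topologicalType) : Prop :=
  exists M : metricType R,
    [/\ separable_space M, complete_metric M & homeomorphic T M].

(* Main.v *)
Require Import Defs.
From HB Require Import structures.
From mathcomp Require Import all_boot all_order all_algebra.
From mathcomp Require Import all_classical reals ereal.
From mathcomp Require Import topology metric_structure normedtype.
From mathcomp Require Import lra finmap.

(* If some nonempty [A] had oscillation at least [eps] on every nonempty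
   relatively open subset, then [A] would meet arbitrarily many pairwise
   disjoint convex open sets, as distinct points have disjoint convex
   neighborhoods.  In each of them two points of [A] whose values differ by
   at least [eps] span a segment; the segments are disjoint, so a finite
   subalgebra containing all the endpoints has variation at least [n * eps]
   for every [n].  Hence [f] is fragmented.
   In a compact Hausdorff or Polish space, nested open subsets of [A] with
   closures and oscillations under control yield a point of continuity.
   On a metric space, a bounded fragmented [f] is Baire 1: exhausting the space
   by open sets gives gauges [delta k] such that [f x] and [f y] are
   [1/(k+1)]-close as soon as [d(x, y)] is less than [delta k x] and
   [delta k y].  Choosing in each ball [B(c, r)] a point [y_c] at which as many
   gauges as possible exceed [2 r], the Lipschitz functions
   [x |-> sup_c min (f y_c, B - 2 B d(x, c) / r)] with [B = sup |f|] converge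
   to [f] as [r] tends to [0]. *)

Set Implicit Arguments.
Unset Strict Implicit.
Unset Printing Implicit Defensive.

Import Order.TTheory GRing.Theory Num.Theory.
Import numFieldNormedType.Exports.

Local Open Scope classical_set_scope.
Local Open Scope ring_scope.

(** * Betweenness in pretrees; convexity of branches and segments *)

Section Pretree.
Context {X : pretreeType}.
Implicit Types (a b c u v x y z : X) (C D : set X).

Lemma btw_xx a b : btw a b b.
Proof. by have [] := (btw_antisym a b b).2 erefl. Qed.

Lemma btw_eq a b c : btw a b c -> btw a c b -> b = c.
Proof. by move=> abc acb; apply/(btw_antisym a). Qed.

Lemma btw_aba a b : btw a b a -> b = a.
Proof. by move=> aba; apply: (btw_eq aba); exact/btw_sym/btw_xx. Qed.

Lemma btw_trans a p y x : btw x p a -> btw p y a -> btw x y a.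
Proof.
move=> xpa pya; case: (btw_split _ _ _ x pya) => // pyx.
suff -> : y = p by [].
have [xpy|ypa] := btw_split _ _ _ y xpa; first exact/(btw_eq _ xpy)/btw_sym.
by apply: (btw_eq (btw_sym _ _ _ pya)); exact: btw_sym.
Qed.

Definition convex C := forall a b, C a -> C b -> segment a b `<=` C.

Lemma convexT : convex setT. Proof. by []. Qed.

Lemma convexI C D : convex C -> convex D -> convex (C `&` D).
Proof.
by move=> cC cD a b [Ca Da] [Cb Db] x xab; split; [exact: cC xab|exact: cD xab].
Qed.

(** A point [z] of [[x, y]] outside the branch has [u] in [[z, v]], hence by (B3) in [[z, x]] and in
    [[z, y]]. This forces [z = u], and (B3) then puts [u] in [[x, v]] or [[y, v]]. *)
Lemma convex_branch u v : convex (branch u v).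
Proof.
move=> x y /= xB yB z; rewrite /segment/= => xzy zuv.
have zux : btw z u x.
  by case: (btw_split _ _ _ x zuv) => // xuv; case: xB.
have zuy : btw z u y.
  by case: (btw_split _ _ _ y zuv) => // yuv; case: yB.
have zu : z = u.
  case: (btw_split _ _ _ u xzy) => h.
    by apply: (btw_eq h); exact: btw_sym.
  by apply: (btw_eq (btw_sym _ _ _ h)); exact: btw_sym.
rewrite -zu in xB yB.
by case: (btw_split _ _ _ v xzy) => // h; apply: yB; exact: btw_sym.
Qed.

Lemma convex_segment a b : convex (segment a b).
Proof.
move=> x y; rewrite /segment/= => axb ayb z xzy.
apply: contrapT => nazb.
have azx : btw x z a.
  case: (btw_split _ _ _ a xzy) => // azy.
  by case: nazb; exact/btw_sym/(btw_trans (btw_sym _ _ _ ayb))/btw_sym.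
by apply: nazb; exact/btw_sym/(btw_trans (btw_sym _ _ _ axb)).
Qed.

Lemma segment_endl a b : segment a b a.
Proof. exact/btw_sym/btw_xx. Qed.

Lemma segment_endr a b : segment a b b.
Proof. exact/btw_xx. Qed.

Lemma open_branch u v : u <> v -> @open (shadow X) (branch u v).
Proof.
move=> uv; apply/shadow_openE; exists [set branch u v];
  last by rewrite bigcup_set1.
by move=> _ ->; apply: (@finI_from1 _ _ _ id); exists u, v.
Qed.

End Pretree.

(** * Medians, separation by convex open sets, finite subalgebras *)

Section Median.
Context {X : medianPretreeType}.
Implicit Types (a b c u v x y z : X) (C D s : set X).

Definition is_median a b c y := [/\ btw a y b, btw a y c & btw b y c].

Lemma is_medianE a b c y : is_median a b c y -> y = median a b c.
Proof. by move=> [? ? ?]; apply: median_unique. Qed.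

Lemma median_is a b c : is_median a b c (median a b c).
Proof. by have [[? ?] ?] := medianP a b c. Qed.

Lemma is_median12 a b c y : is_median a b c y -> is_median b a c y.
Proof. by case=> ? ? ?; split=> //; exact: btw_sym. Qed.

Lemma is_median23 a b c y : is_median a b c y -> is_median a c b y.
Proof. by case=> ? ? ?; split=> //; exact: btw_sym. Qed.

Lemma btw_meet x b c p y : btw x p b -> btw x p c -> btw b y c -> btw x p y.
Proof.
move=> xpb xpc byc; wlog byp : b c xpb xpc byc / btw b y p.
  move=> H; have [byp|pyc] := btw_split _ _ _ p byc; first exact: (H b c).
  by apply: (H c b) => //; exact: btw_sym.
have [//|ypb] := btw_split _ _ _ y xpb.
rewrite (btw_eq byp (btw_sym _ _ _ ypb)); exact: btw_xx.
Qed.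

(** Two branches, [branch w u] and [branch z v], do it: they are disjoint once every [x] has [w] in
    [[x, u]] or [z] in [[x, v]]. *)
Lemma convex_open_separation u v : u <> v -> exists C D : set X,
  [/\ open (C : set (shadow X)), convex C & C u] /\
  [/\ open (D : set (shadow X)), convex D, D v & C `&` D = set0].
Proof.
move=> uv.
have [w [z [wu zv wz]]] : exists w z, [/\ w <> u, z <> v &
    forall x, btw x w u \/ btw x z v].
  (* By (B3), a point strictly between [u] and [v] serves as both [w] and [z]. If there is none, the
     median of [x], [u], [v] is [u] or [v], so [w = v] and [z = u] work. *)
  have [[w [uwv wu wv]]|nw] :=
    pselect (exists w, [/\ btw u w v, w <> u & w <> v]).
    exists w, w; split => // x.
    by have [/btw_sym|] := btw_split _ _ _ x uwv; [left|right].
  exists v, u; split => [/esym//|//|x].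
  have [xyu xyv uyv] := median_is x u v.
  have [yu|yu] := pselect (median x u v = u); first by right; rewrite -yu.
  have [yv|yv] := pselect (median x u v = v); first by left; rewrite -yv.
  by case: nw; exists (median x u v).
exists (branch w u), (branch z v); split.
  split; [exact: open_branch|exact: convex_branch|].
  by rewrite /branch/segment/= => /btw_aba.
split; [exact: open_branch|exact: convex_branch| |].
  by rewrite /branch/segment/= => /btw_aba.
by rewrite -subset0 => x [/= xw xz]; have [] := wz x.
Qed.

(* [p] is the gate of [x] in the hull of [a :: r]. *)
Lemma gate (x a : X) (r : seq X) : exists p a0 b0,
  [/\ a0 \in a :: r, b0 \in a :: r, btw a0 p b0 &
      forall c, c \in a :: r -> btw x p c].
Proof.
elim: r => [|c r [p [a0 [b0 [a0r b0r pab pr]]]]].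
  exists a, a, a; rewrite inE eqxx; split => //; first exact: btw_xx.
  by move=> c; rewrite inE => /eqP ->; exact: btw_xx.
have sub d : d \in a :: r -> d \in [:: a, c & r].
  by rewrite !inE => /orP[->//|->]; rewrite !orbT.
have mem d : d \in [:: a, c & r] -> d = c \/ d \in a :: r.
  rewrite !inE => /or3P[->|/eqP|->]; [by right|by left|by right; rewrite orbT].
(* The gate moves to [q] when [c] is added. If [q] is not [p], it lies in [[c, a0]], because
   otherwise [q] would be in [[a0, p]], forcing [q = p]. *)
pose q := median x p c; have [xqp xqc pqc] := median_is x p c.
have [qp|qp] := pselect (q = p).
  exists p, a0, b0; split => //; [exact: sub|exact: sub|move=> d /mem[->|]].
    by move: xqc; rewrite -/q qp.
  exact: pr.
exists q, c, a0; split; [by rewrite !inE eqxx orbT|exact: sub| |].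
  have [//|pqa] := btw_split _ _ _ a0 (btw_sym _ _ _ pqc).
  have pqa0 : btw p q a0 by exact: btw_sym.
  case: qp; have [xpq|qpa] := btw_split _ _ _ q (pr _ a0r).
    exact: (btw_eq xqp xpq).
  by apply: (btw_eq (btw_sym _ _ _ pqa0)); exact: btw_sym.
move=> d /mem[->//|/pr xpd].
exact/btw_sym/(btw_trans (btw_sym _ _ _ xpd))/btw_sym.
Qed.

(** It suffices to add [x] and its gate [p]: a median of [x] and two points of [s] is either [p] or
    a median of three points of [s]. *)
Lemma subalgebra_extend s x : finite_set s -> subalgebra s ->
  exists t, [/\ finite_set t, subalgebra t, s `<=` t & t x].
Proof.
have sub1 (t : set X) : (forall a b c, t a -> t b -> t c ->
    exists2 y, t y & is_median a b c y) -> subalgebra t.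
  by move=> H a b c ta tb tc; have [y ty /is_medianE <-] := H _ _ _ ta tb tc.
move=> fs sa; have /finite_seqP[[|a r] sE] := fs.
  exists [set x]; split => //; last by rewrite sE.
  apply: sub1 => _ _ _ -> -> ->; exists x => //; split; exact: btw_xx.
have [p [a0 [b0 [a0r b0r pab par]]]] := gate x a r.
have sa0 : s a0 by rewrite sE.
have sb0 : s b0 by rewrite sE.
have pr c : s c -> btw x p c by rewrite sE => /par.
pose t := s `|` [set x; p].
exists t; split; [|apply: sub1|by move=> y; left|by right; left].
  by rewrite !finite_setU; split => //.
(* If [y] is not in [[x, d]] for some [d] in [s], then (B3) makes [y] the median of [b], [c], [d].
   Otherwise [y] is in [[x, a0]] and [[x, b0]], hence in [[x, p]], while [p] is in [[x, y]] by the
   gate property; so [y = p]. *)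
have key b c y : s b -> s c -> is_median x b c y -> t y.
  move=> sb sc xbcy; have [xyb xyc byc] := xbcy.
  have H d : s d -> ~ btw x y d -> t y.
    move=> sd nxyd; left; rewrite (@is_medianE b c d y); first exact: sa.
    split => //; apply/btw_sym.
      by have [//|//] := btw_split _ _ _ d xyb.
    by have [//|//] := btw_split _ _ _ d xyc.
  have [xya|] := pselect (btw x y a0); last exact: H.
  have [xyb0|] := pselect (btw x y b0); last exact: H.
  right; right; apply: (@btw_eq _ x).
    exact: btw_meet xya xyb0 pab.
  exact: btw_meet (pr _ sb) (pr _ sc) byc.
have medx b c : s b -> s c -> exists2 y, t y & is_median x b c y.
  move=> sb sc; exists (median x b c); last exact: median_is.
  by apply: (key b c) => //; exact: median_is.
have medp b c : s b -> s c -> exists2 y, t y & is_median p b c y.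
  move=> sb sc; exists (median p b c); last exact: median_is.
  have [pyb pyc byc] := median_is p b c.
  apply: (key b c) => //; split => //.
    exact: btw_trans (pr _ sb) pyb.
  exact: btw_trans (pr _ sc) pyc.
have medxp b : s b -> exists2 y, t y & is_median x p b y.
  move=> sb; exists p; first by right; right.
  by split; [exact: btw_xx|exact: pr|exact/btw_sym/btw_xx].
have meds b c d : s b -> s c -> s d -> exists2 y, t y & is_median b c d y.
  move=> sb sc sd; exists (median b c d); last exact: median_is.
  by left; exact: sa.
have medd b c : t b -> t c -> exists2 y, t y & is_median b b c y.
  move=> tb tc; exists b => //.
  by split; [exact: btw_xx|exact/btw_sym/btw_xx|exact/btw_sym/btw_xx].
have s12 b c d : (exists2 y, t y & is_median b c d y) ->
    exists2 y, t y & is_median c b d y.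
  by move=> [y ty /is_median12]; exists y.
have s23 b c d : (exists2 y, t y & is_median b c d y) ->
    exists2 y, t y & is_median b d c y.
  by move=> [y ty /is_median23]; exists y.
have tx : t x by right; left.
have tp : t p by right; right.
move=> b c d tb tc td; move: (tb) (tc) (td).
case=> [sb|[->|->]]; case=> [sc|[->|->]]; case=> [sd|[->|->]]; by auto 6.
Qed.

Lemma finite_subalgebra s : finite_set s ->
  exists t, [/\ finite_set t, subalgebra t & s `<=` t].
Proof.
move=> /finite_seqP[r ->]; elim: r => [|x r [t [ft at_ rt]]].
  by exists set0; split => // a b c [].
have [t' [ft' at' tt' t'x]] := subalgebra_extend x ft at_.
exists t'; split => // y; rewrite /= inE => /orP[/eqP -> //|yr].
exact/tt'/rt.
Qed.

End Median.

(** * Variation along finite sets; bounded variation implies fragmentation *)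

Lemma ler_fsum_subset (R : numDomainType) (I : choiceType) (A B : set I)
    (F : I -> R) : finite_set B -> A `<=` B -> (forall i, B i -> 0 <= F i) ->
  \sum_(i \in A) F i <= \sum_(i \in B) F i.
Proof.
move=> finB AB F0; rewrite (fsbigID A B F finB) (setIidr AB) lerDl.
by apply: fsumr_ge0 => i [/F0].
Qed.

Section Variation.
Context {R : realType} {X : medianPretreeType}.
Implicit Types (f : X -> R) (s C D : set X).

Lemma finite_adj s : finite_set s -> finite_set (adj s).
Proof.
move=> fs.
apply: (@sub_finite_set _ _ ((fun ab => [set ab.1; ab.2]) @` (s `*` s))).
  move=> e [a [b [_ eab es _]]]; exists (a, b) => //=.
  by split; apply: es; rewrite eab; [left|right].
by apply: finite_image; exact: finite_setX.
Qed.

Lemma jump_ge0 f s e : adj s e -> 0 <= jump f e.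
Proof. by move=> [a [b [_ -> _ _]]]; rewrite jump2. Qed.

(** Localizing the variation to the doublets inside [C] makes it superadditive over disjoint
    regions. *)
Definition variation_in f s C : R :=
  \sum_(e \in adj s `&` [set e | e `<=` C]) jump f e.

Lemma variation_inT f s : variation_in f s setT = Upsilon_on f s.
Proof. by congr (\sum_(e \in _) _); apply/seteqP; split => // e []. Qed.

Lemma variation_in_ge0 f s C : 0 <= variation_in f s C.
Proof. by apply: fsumr_ge0 => e [/jump_ge0]. Qed.

Lemma le_variation_in f s C D : finite_set s -> C `<=` D ->
  variation_in f s C <= variation_in f s D.
Proof.
move=> fs CD; apply: ler_fsum_subset => [|e [se eC]|e [/jump_ge0//]].
  exact/finite_setIl/finite_adj.
by split => //; exact: subset_trans CD.
Qed.

Lemma variation_inD f s C D E : finite_set s -> C `<=` E -> D `<=` E ->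
  (forall e, adj s e -> e `<=` C -> ~ e `<=` D) ->
  variation_in f s C + variation_in f s D <= variation_in f s E.
Proof.
move=> fs CE DE CD; rewrite /variation_in -fsbigU/=; last first.
- by move=> e [[se eC] [_ eD]]; case: (CD e).
- exact/finite_setIl/finite_adj.
- exact/finite_setIl/finite_adj.
apply: ler_fsum_subset => [|e|e [/jump_ge0//]].
  exact/finite_setIl/finite_adj.
by case=> -[se eC]; split => //; exact: (subset_trans eC).
Qed.

(** Induction on the number of points of [s] in [[a, b]]. A point [c] of [s] strictly inside gives
    [[a, c]] and [[c, b]], which meet only in [c] and so share no doublet; the triangle inequality
    adds up their bounds. Without such a point, [a] and [b] form an adjacent doublet. *)
Lemma dist_le_variation_segment f s a b : finite_set s -> s a -> s b ->
  `|f a - f b| <= variation_in f s (segment a b).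
Proof.
move=> fs; have [n] := ubnP #|` fset_set (segment a b `&` s)|.
elim: n => // n IH in a b * => sab sa sb.
have [->|ab] := pselect (a = b); first by rewrite subrr normr0 variation_in_ge0.
have [[c [acb sc ca cb]]|nc] :=
    pselect (exists c, [/\ btw a c b, s c, c <> a & c <> b]).
  have smaller C e : C `<=` segment a b -> s e -> btw a e b -> ~ C e ->
      (#|` fset_set (C `&` s)| < n)%N.
    move=> Cab se aeb nCe; rewrite -ltnS; apply: leq_trans sab.
    have inS D x : (x \in fset_set (D `&` s)) = (x \in D `&` s).
      by rewrite in_fset_set//; exact: finite_setIr.
    rewrite ltnS; apply: fproper_ltn_card; rewrite fproperE; apply/andP; split.
      apply/fsubsetP => x; rewrite !inS => /set_mem[Cx sx].
      by apply/mem_set; split => //; exact: Cab.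
    apply/fsubsetP => /(_ e); rewrite !inS => /(_ (mem_set _)) eC.
    by have /set_mem[] := eC (conj aeb se).
  have sac : segment a c `<=` segment a b.
    exact: convex_segment (segment_endl a b) acb.
  have scb : segment c b `<=` segment a b.
    exact: convex_segment acb (segment_endr a b).
  have Hac := IH a c _ sa sc; have Hcb := IH c b _ sc sb.
  apply: le_trans (variation_inD f fs sac scb _); last first.
    move=> e [d [d' [dd' -> _ _]]] dac dcb; apply: dd'.
    have cE x : [set d; d'] x -> x = c.
      move=> dx; have axc := dac _ dx; have /btw_sym bxc := dcb _ dx.
      have [acx|/btw_sym bcx] := btw_split _ _ _ x acb.
        exact: btw_eq axc acx.
      exact: btw_eq bxc bcx.
    by rewrite (cE d (or_introl erefl)) (cE d' (or_intror erefl)).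
  rewrite -(subrKA (f c)) (le_trans (ler_normD _ _))// lerD//.
    apply/Hac/(smaller _ b) => //; first exact: btw_xx.
    by move=> abc; apply: cb; exact: btw_eq acb abc.
  apply/Hcb/(smaller _ a) => //; first exact: segment_endl.
  by move=> /btw_sym bac; apply: ca; exact: btw_eq (btw_sym _ _ _ acb) bac.
suff : adj s [set a; b].
  move=> sab'; have <- : \sum_(e \in [set [set a; b]]) jump f e = `|f a - f b|.
    by rewrite fsbig_set1 jump2.
  apply: ler_fsum_subset => [|_ ->|e [/jump_ge0//]].
    exact/finite_setIl/finite_adj.
  by split => //= x [->|->]; [exact: segment_endl|exact: segment_endr].
exists a, b; split => //; first by move=> x [->|->].
apply/seteqP; split => [x [axb sx]|x [->|->]].
- apply: contrapT => nx; apply: nc; exists x.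
  by split => // xE; apply: nx; [left|right]; exact: xE.
- by split => //; exact: segment_endl.
- by split => //; exact: segment_endr.
Qed.

(** Induction on [n]: a pair [u], [v] of oscillation [eps] is separated by disjoint convex open sets
    [C] and [D]. Inside [C] the induction hypothesis gives [n] jumps; a fresh pair inside [D] gives
    one more, its segment staying in [D] by convexity. *)
Lemma variation_in_unbounded f (A : set X) (eps : R) : 0 < eps ->
  (forall O, open (O : set (shadow X)) -> convex O -> A `&` O !=set0 ->
    exists a b, [/\ (A `&` O) a, (A `&` O) b & eps <= `|f a - f b|]) ->
  forall n O, open (O : set (shadow X)) -> convex O -> A `&` O !=set0 ->
    exists F, [/\ finite_set F, F `<=` O & forall s, finite_set s -> F `<=` s ->
      eps *+ n <= variation_in f s O].
Proof.
move=> eps0 osc; elim=> [|n IH] O oO cO AO.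
  by exists set0; split => // s _ _; rewrite mulr0n variation_in_ge0.
have [u [v [[Au Ou] [Av Ov] uv]]] := osc O oO cO AO.
have /convex_open_separation[C [D [[oC cC Cu] [oD cD Dv CD]]]] : u <> v.
  by move=> E; move: uv; rewrite E subrr normr0 leNgt eps0.
have oCO := openI oC oO; have oDO := openI oD oO.
have cCO := convexI cC cO; have cDO := convexI cD cO.
have [|F [fF FC FV]] := IH _ oCO cCO; first by exists u.
have [|a [b [[_ Da] [_ Db] ab]]] := osc _ oDO cDO; first by exists v.
exists (F `|` [set a; b]); split.
- by rewrite !finite_setU; split => //; split; exact: finite_set1.
- by move=> x [/FC[]//|[->|->]]; [case: Da|case: Db].
move=> s fs Fs; rewrite mulrSr.
apply: le_trans (@variation_inD f s (C `&` O) (D `&` O) O fs _ _ _).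
- apply: lerD; first by apply: FV => // x Fx; apply: Fs; left.
  apply: le_trans ab _.
  apply: le_trans (le_variation_in f fs (cDO a b Da Db)).
  apply: dist_le_variation_segment => //; apply: Fs; right; [by left|by right].
- by move=> x [].
- by move=> x [].
- move=> e [d [d' [_ -> _ _]]] eC eD.
  have : (C `&` D) d by split; [case: (eC d)|case: (eD d)] => //; left.
  by rewrite CD.
Qed.

Lemma bv_fragmented f (A : set X) (eps : R) : has_bounded_variation f ->
  A !=set0 -> 0 < eps ->
  exists O, [/\ open (O : set (shadow X)), A `&` O !=set0 &
    forall a b, (A `&` O) a -> (A `&` O) b -> `|f a - f b| < eps].
Proof.
move=> [_ bv] A0 eps0; apply: contrapT => nO.
have osc O : open (O : set (shadow X)) -> convex O -> A `&` O !=set0 ->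
    exists a b, [/\ (A `&` O) a, (A `&` O) b & eps <= `|f a - f b|].
  move=> oO _ AO; apply: contrapT => nab; apply: nO; exists O.
  split => // a b Aa Ab.
  by rewrite ltNge; apply/negP => ab; apply: nab; exists a, b.
have [M MU] : exists M : R,
    forall s, finite_set s -> subalgebra s -> Upsilon_on f s <= M.
  (* No default value of [fine] occurs: [bv] excludes [+oo], and the finite lower bound given by [s]
     excludes [-oo]. *)
  exists (fine (Upsilon f)) => s fs ss.
  have : ((Upsilon_on f s)%:E <= Upsilon f)%E.
    by apply: ereal_sup_ubound; exists s.
  by move: bv; case: (Upsilon f).
have [n Mn] : exists n, M < eps *+ n.
  exists (Num.bound `|M / eps|); rewrite -mulr_natr mulrC -ltr_pdivrMr//.
  by rewrite (le_lt_trans (ler_norm _))// archi_boundP.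
have [|F [fF _ FV]] := variation_in_unbounded eps0 osc n openT convexT.
  by rewrite setIT.
have [s [fs ss Fs]] := finite_subalgebra fF.
have := le_trans (FV s fs Fs); rewrite variation_inT => /(_ _ (MU s fs ss)).
by rewrite leNgt Mn.
Qed.

End Variation.

(** * Fragmented functions and points of continuity *)

Definition fragmented (R : realType) (T : topologicalType) (f : T -> R) :=
  forall (A : set T) (eps : R), A !=set0 -> 0 < eps ->
    exists O, [/\ open O, A `&` O !=set0 &
      forall a b, (A `&` O) a -> (A `&` O) b -> `|f a - f b| < eps].

(** [Q n U] is a smallness condition on the [n]-th set: trivial for compact spaces, a diameter bound
    for Polish ones. Open sets meeting [A] are nested so that each closure lies in the previous set
    and the [n]-th oscillation on [A] is below [1/(n+1)]; a cluster point of points chosen in them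
    lies in [A] and in all of them. *)
Lemma fragmented_pcp (R : realType) (T : topologicalType)
    (Q : nat -> set T -> Prop) (f : T -> R) :
  (forall n x N, nbhs x N ->
     exists U, [/\ open U, U x, closure U `<=` N & Q n U]) ->
  (forall (U : nat -> set T) (x : nat -> T), (forall n, Q n (U n)) ->
     (forall n m, (n <= m)%N -> U n (x m)) -> cluster (x @ \oo) !=set0) ->
  fragmented f -> point_of_continuity_property f.
Proof.
move=> refine clusters frag A A0 clA.
pose S := {O : set T | open O /\ A `&` O !=set0}.
have /choice[next nextP] : forall p : nat * S, exists O : S,
    [/\ closure (sval O) `<=` sval p.2, Q p.1 (sval O) &
      forall a b, (A `&` sval O) a -> (A `&` sval O) b ->
        `|f a - f b| < p.1.+1%:R^-1].
  move=> [n [O [oO AO]]] /=.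
  have [|O1 [oO1 [y [[Ay Oy] O1y]] osc]] := frag _ n.+1%:R^-1 AO.
    by rewrite invr_gt0.
  have [|U [oU Uy UO QU]] := refine n y (O `&` O1).
    by apply: open_nbhs_nbhs; split => //; exact: openI.
  have AU : A `&` U !=set0 by exists y.
  have UOO1 : U `<=` O `&` O1 by apply: subset_trans UO; exact: subset_closure.
  exists (exist _ U (conj oU AU)); split => //=.
    by move=> z /UO[].
  move=> a b [Aa /UOO1[Oa O1a]] [Ab /UOO1[Ob O1b]].
  by apply: osc.
have oT : open [set: T] /\ A `&` setT !=set0.
  by split; [exact: openT|rewrite setIT].
pose O := fix O n : S := if n is m.+1 then next (m, O m) else exist _ setT oT.
(* The shift drops the initial whole space, so that [U n] satisfies [Q n] and the oscillation bound
   [1/(n+1)]. *)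
pose U n := sval (O n.+1).
have UU n : closure (U n.+1) `<=` U n by have [] := nextP (n.+1, O n.+1).
have Umono n m : (n <= m)%N -> U m `<=` U n.
  elim: m => [|m IH]; first by rewrite leqn0 => /eqP ->.
  rewrite leq_eqVlt => /predU1P[->//|/IH]; apply: subset_trans.
  by apply: subset_trans (UU m); exact: subset_closure.
have /choice[x xP] : forall n, exists y, (A `&` U n) y.
  by move=> n; have [] := svalP (O n.+1).
have [|n m nm|l cl]  := clusters U x.
- by move=> n; have [] := nextP (n, O n).
- by apply: Umono nm _ _; have [] := xP m.
have clU n : U n l.
  apply: UU; move: cl; rewrite clusterE; apply; exists n.+1 => // m nm.
  by apply: (Umono _ _ nm); have [] := xP m.
have Al : A l.
  rewrite (closure_id A).1//; move: cl; rewrite clusterE; apply.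
  by exists 0%N => // m _; have [] := xP m.
exists l => //.
apply/cvgrPdist_lt => eps eps0.
have [n _ /(_ n (leqnn n)) nE] := near_infty_natSinv_lt (PosNum eps0).
rewrite /nbhs/= -nbhs_subspace_in//.
apply: filterS (open_nbhs_nbhs (conj (svalP (O n.+1)).1 (clU n))) => y Uy Ay.
apply: lt_trans nE.
have [_ _ osc] := nextP (n, O n).
by apply: osc; split => //; exact: clU.
Qed.

Lemma compact_fragmented_pcp (R : realType) (T : topologicalType) (f : T -> R) :
  hausdorff_space T -> compact [set: T] -> fragmented f ->
  point_of_continuity_property f.
Proof.
move=> hT cT; apply: (@fragmented_pcp _ _ (fun _ _ => True)).
  move=> _ x N /(compact_regular hT cT filterT)[W xW WN].
  exists (interior W); split; [exact: open_interior|exact: xW| |by []].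
  apply: subset_trans WN; apply: closure_subset; exact: interior_subset.
move=> _ x _ _.
have [l [_ cl]] := cT (x @ \oo) _ filterT.
by exists l.
Qed.

(** With [Q n U] bounding distances in the image of [U] under [h] by [1/(n+1)], a sequence
    eventually in every [U n] has a Cauchy image, whose limit is pulled back by [k] to a cluster
    point. *)
Lemma polish_fragmented_pcp (R : realType) (T : topologicalType) (f : T -> R) :
  polish R T -> fragmented f -> point_of_continuity_property f.
Proof.
move=> [M [_ complM [h [k [hK kK ch ck]]]]].
apply: (@fragmented_pcp _ _ (fun n U => forall x y, U x -> U y ->
  ball (h x) n.+1%:R^-1 (h y))).
  move=> n x N xN.
  have : nbhs (h x) (k @^-1` N) by apply: ck; rewrite hK.
  move=> /uniform_regular[W hxW WN].
  pose V := h @^-1` (W `&` ball (h x) (n.+1%:R^-1 / 2)).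
  exists (interior V); split; [exact: open_interior| | |].
  - apply: ch; apply: filterI => //; apply: nbhsx_ballx.
    by rewrite divr_gt0.
  - move=> y Vy; rewrite -(hK y); apply: WN => B /ch yB.
    by have [z [/interior_subset[Wz _] Bz]] := Vy _ yB; exists (h z).
  - move=> y z /interior_subset[_ xy] /interior_subset[_ xz].
    exact: ball_splitr xz.
move=> U x QU Ux.
have [|l hxl] := complM (h \o x @ \oo) _.
  apply/cauchyP => e e0.
  have [n _ /(_ n (leqnn n)) nE] := near_infty_natSinv_lt (PosNum e0).
  exists (h (x n)); exists n => // m nm; apply: le_ball (ltW nE) _ _.
  by apply: QU; exact: Ux.
exists (k l) => B C xB klC.
have xC : (x @ \oo) C.
  have : nbhs \oo ((h \o x) @^-1` (k @^-1` C)) by exact: (hxl _ (ck l _ klC)).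
  by apply: (@filterS _ \oo _ _ (x @^-1` C)) => n /=; rewrite hK.
exact: filter_ex (filterI xB xC).
Qed.

(** * Gauges and Baire 1 approximation on metric spaces *)

Section Baire1.
Context {R : realType} {M : metricType R}.
Implicit Types (f : M -> R) (x y : M).

Let metric_ballP x r y : ball x r y <-> mdist x y < r.
Proof. by rewrite ballEmdist. Qed.

(** Zorn's lemma gives a maximal partial gauge [d] for the order of extension. If [d] vanished
    somewhere, fragmentation of its zero set would yield an open [O] meeting that set, over which
    [d] could be extended. *)
Lemma fragmented_gauge f (eps : R) : fragmented f -> 0 < eps ->
  exists delta : M -> R, (forall x, 0 < delta x) /\
    forall x y, mdist x y < delta x -> mdist x y < delta y ->
      `|f x - f y| < eps.
Proof.
move=> frag eps0.
pose gauge (d : M -> R) := [/\ forall x, 0 <= d x,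
  forall x y, mdist x y < d x -> 0 < d y &
  forall x y, mdist x y < d x -> mdist x y < d y -> `|f x - f y| < eps].
(* [d] is a gauge on the open set where it is positive. *)
pose le (d e : {d | gauge d}) :=
  `[< forall x, 0 < sval d x -> sval e x = sval d x >].
have [| | |A totA|[d [d0 dO dosc]] dmax] := @Zorn {d | gauge d} le.
- by move=> d; apply/asboolP.
- move=> d e g /asboolP de /asboolP eg; apply/asboolP => x dx.
  by rewrite eg ?de.
- move=> [d gd] [e ge] /asboolP/= de /asboolP/= ed.
  have E : d = e.
    apply/funext => x; have [d0 _ _] := gd; have [e0 _ _] := ge.
    move: (d0 x) (e0 x); rewrite !le_eqVlt.
    by move=> /predU1P[dx|/de//] /predU1P[ex|/ed//]; rewrite -dx -ex.
  by subst e; rewrite (Prop_irrelevance gd ge).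
(* Upper bound of the chain [A]: members positive at [x] agree there, and the default 0 is taken
   where none is positive. *)
- pose D x := xget 0 [set r | 0 < r /\ exists2 s, A s & sval s x = r].
  have DE s x : A s -> 0 < sval s x -> D x = sval s x.
    move=> As sx; apply: xget_unique => [|r [r0 [t At tr]]].
      by split => //; exists s.
    rewrite -tr in r0 *.
    by have [/asboolP ->|/asboolP ->] := totA _ _ As At.
  have Dex x : 0 < D x -> exists2 s, A s & D x = sval s x.
    rewrite /D; case: xgetP => [r _ [_ [s As <-]]|_]; last by rewrite ltxx.
    by exists s.
  have D2 x y : 0 < D x -> 0 < D y ->
      exists s, [/\ A s, D x = sval s x & D y = sval s y].
    move=> Dx Dy; have [s As sx] := Dex _ Dx; have [t At ty] := Dex _ Dy.
    have [/asboolP st|/asboolP ts] := totA _ _ As At.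
      by exists t; split => //; rewrite st -?sx.
    by exists s; split => //; rewrite ts -?ty.
  have gD : gauge D.
    split.
    - by move=> x; rewrite /D; case: xgetP => [r _ [/ltW]|].
    - move=> x y xy; have [|s As sx] := Dex x.
        exact: le_lt_trans (mdist_ge0 _ _) xy.
      have [_ sO _] := svalP s.
      have sy : 0 < sval s y by apply: (sO x); rewrite -sx.
      by rewrite (DE s).
    - move=> x y xy yx; have [||s [As sx sy]] := D2 x y.
      + exact: le_lt_trans (mdist_ge0 _ _) xy.
      + exact: le_lt_trans (mdist_ge0 _ _) yx.
      have [_ _] := svalP s; apply; by rewrite -?sx -?sy.
  exists (exist _ D gD) => s As; apply/asboolP => x sx /=.
  exact: DE.
have [dgt0|] := pselect (forall x, 0 < d x); first by exists d.
move=> /existsNP[x0 /negP dx0].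
have [|O [oO [x1 [dx1 Ox1]] osc]] := frag [set x | ~ 0 < d x] eps _ eps0.
  by exists x0 => /=; exact/negP.
(* A point within [rho x] of [x] stays in [O], where [f] oscillates by less than [eps] on the zero
   set of [d]. *)
have /choice[rho rhoP] : forall x, exists r, O x -> 0 < r /\ ball x r `<=` O.
  move=> x; have [Ox|] := pselect (O x); last by exists 0.
  by have /nbhs_ballP[r /= r0 rO] := open_nbhs_nbhs (conj oO Ox); exists r.
pose e x := if 0 < d x then d x else if x \in O then rho x else 0.
have eE x : 0 < d x -> e x = d x by rewrite /e => ->.
have eO x : ~ 0 < d x -> O x -> e x = rho x.
  by move=> /negP/negbTE dx Ox; rewrite /e dx mem_set.
have e_ge0 x : 0 <= e x.
  rewrite /e; case: ifPn => [/ltW//|_]; case: ifPn => // /set_mem Ox.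
  by have [/ltW] := rhoP x Ox.
have e_cases x y : mdist x y < e x ->
    0 < d x \/ [/\ ~ 0 < d x, O x & e x = rho x].
  have [dx|dx] := pselect (0 < d x); first by left.
  have [Ox|nOx] := pselect (O x); first by right; rewrite eO.
  rewrite /e (negbTE (introN idP dx)) memNset//.
  move=> /(le_lt_trans (mdist_ge0 _ _)).
  by rewrite ltxx.
have ge : gauge e.
  split => // x y xy.
  - have [dx|[dx Ox ex]] := e_cases _ _ xy.
      have dy : 0 < d y by apply: (dO x); rewrite -eE.
      by rewrite eE.
    have Oy : O y by apply: (rhoP x Ox).2; apply/metric_ballP; rewrite -ex.
    have [dy|dy] := pselect (0 < d y); first by rewrite eE.
    by rewrite eO//; have [] := rhoP y Oy.
  - rewrite metric_sym => yx.
    have [dx|[dx Ox ex]] := e_cases _ _ xy;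
      have [dy|[dy Oy ey]] := e_cases _ _ yx.
    + by apply: (dosc x y); rewrite -eE// metric_sym.
    + by case: dy; apply: (dO x); rewrite -eE.
    + by case: dx; apply: (dO y); rewrite -eE.
    + by apply: osc.
have := dmax (exist _ e ge).
have -> : le (exist _ d (And3 d0 dO dosc)) (exist _ e ge).
  by apply/asboolP => x /= /eE.
move=> /(_ isT)/(congr1 (fun g => sval g x1))/= de.
by case: (dx1); rewrite -de eO//; have [] := rhoP x1 Ox1.
Qed.

(** A pointwise supremum of [L]-Lipschitz functions is [L]-Lipschitz; [B] and [i0] make it the
    supremum of a bounded nonempty set. *)
Lemma lipschitz_sup (I : Type) (h : I -> M -> R) (B L : R) (i0 : I) :
  0 < L -> (forall i x, h i x <= B) ->
  (forall i x y, h i x <= h i y + L * mdist x y) ->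
  continuous (fun x => sup (range (h^~ x))).
Proof.
move=> L0 hB hL x; set F := fun _ => _.
have Fle y z : F y <= F z + L * mdist y z.
  apply: ge_sup; first by exists (h i0 y), i0.
  move=> _ [i _ <-]; apply: le_trans (hL i y z) _; rewrite lerD2r.
  by apply: ub_le_sup; [exists B => _ [j _ <-]|exists i].
apply/cvgrPdist_lt => eps eps0.
apply: filterS (nbhsx_ballx x (eps / L) (divr_gt0 eps0 L0)) => y.
rewrite ballEmdist/= ltr_pdivlMr// => xy.
have := Fle x y; have := Fle y x; rewrite (metric_sym y x) (mulrC L) => yx' xy'.
by rewrite ltr_norml; apply/andP; split; lra.
Qed.

Lemma fragmented_Baire1 f : bounded_fun f -> fragmented f -> Baire1 f.
Proof.
move=> bf frag.
have [B [B0 fB]] : exists B : R, 0 < B /\ forall x, `|f x| <= B.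
  have [N [_ NP]] := bf; exists (Num.max 0 N + 1).
  have N1 : N < Num.max 0 N + 1 by rewrite ltr_pwDr// le_max lexx orbT.
  by split=> [|x]; [rewrite ltr_pwDr// le_max lexx|exact: NP].
have /choice[delta deltaP] : forall k : nat, exists d : M -> R,
    (forall x, 0 < d x) /\ forall x y, mdist x y < d x -> mdist x y < d y ->
      `|f x - f y| < k.+1%:R^-1.
  by move=> k; apply: fragmented_gauge => //; rewrite invr_gt0.
pose r n : R := n.+1%:R^-1.
have r0 n : 0 < r n by rewrite invr_gt0.
pose good n N y := forall j, (j < N)%N -> 2 * r n < delta j y.
have /choice[pick pickP] : forall p : nat * M, exists y, mdist p.2 y < r p.1 /\
    forall N, (N <= p.1)%N ->
      (exists2 z, mdist p.2 z < r p.1 & good p.1 N z) -> good p.1 N y.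
  (* Induction on a cap [m] for [N]: a point of the ball that is good for [m.+1] gauges, if any,
     replaces the previous choice and is good for every smaller [N] too. *)
  move=> [n c] /=; elim: {2}n => [|m [y [cy yP]]].
    by exists c; rewrite mdistxx; split => // N; rewrite leqn0 => /eqP -> _ j.
  have [[z cz zm]|nz] := pselect (exists2 z, mdist c z < r n & good n m.+1 z).
    by exists z; split => // N Nm _ j jN; apply: zm; exact: leq_trans Nm.
  exists y; split => // N; rewrite leq_eqVlt => /predU1P[->//|]; exact: yP.
pose L n := 2 * B / r n.
have L0 n : 0 < L n by rewrite divr_gt0// mulr_gt0.
(* The cone is at most [-B] at distance [r n] or more from [c], so far centres never push the
   supremum above [f x]. *)
pose h n c x := Num.min (f (pick (n, c))) (B - L n * mdist x c).
have hB n c x : h n c x <= B.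
  by rewrite /h ge_min (le_trans (ler_norm _) (fB _)).
exists (fun n x => sup (range (fun c => h n c x))); split.
  move=> n x; move: (x); apply: (@lipschitz_sup _ (h n) B (L n) x) => // c y z.
  rewrite /h; set a := f _.
  have yz : L n * mdist z c <= L n * mdist y z + L n * mdist y c.
    rewrite -mulrDr ler_pM2l//.
    by apply: le_trans (metric_triangle _ y _) _; rewrite (metric_sym z y).
  have := mulr_ge0 (ltW (L0 n)) (mdist_ge0 y z).
  by move: yz; rewrite /Num.min; case: ifPn; case: ifPn; rewrite -?leNgt; lra.
move=> x; apply/cvgrPdist_lt => eps eps0.
have [N _ /(_ N (leqnn N)) Neps] := near_infty_natSinv_lt (PosNum eps0).
set e : R := N.+1%:R^-1 in Neps.
have e0 : 0 < e by rewrite invr_gt0.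
(* Gauges [0] to [N] are positive at [x] while [2 r n] tends to 0; gauge [N] is the one with
   tolerance [e]. *)
have ev : \forall n \near \oo, good n N.+1 x.
  elim: N.+1 => [|m IH]; first by near=> n => j.
  have dx : 0 < delta m x / 2 by rewrite divr_gt0//; have [] := deltaP m.
  near=> n => j; rewrite ltnS leq_eqVlt => /predU1P[->|].
    rewrite mulrC -ltr_pdivlMr//; near: n.
    exact: (near_infty_natSinv_lt (PosNum dx)).
  by move: j; near: n.
near=> n.
have gx : good n N.+1 x by near: n.
have Nn : (N < n)%N by near: n; exact: nbhs_infty_gt.
(* [x] is itself a good point of the ball around [c], so the picked point is as good; [N < n] allows
   [pickP] at [N.+1]. *)
have close c : mdist x c < r n -> `|f x - f (pick (n, c))| < e.
  move=> xc; have [/= cy gy] := pickP (n, c).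
  have {}gy : good n N.+1 (pick (n, c)).
    by apply: gy => //; exists x => //; rewrite metric_sym.
  have xy : mdist x (pick (n, c)) < 2 * r n.
    by apply: le_lt_trans (metric_triangle _ c _) _; rewrite mulrDl mul1r ltrD.
  by apply: (deltaP N).2; apply: (lt_trans xy); [exact: gx|exact: gy].
have lo : f x - e <= sup (range (fun c => h n c x)).
  apply: (@le_trans _ _ (h n x x)); last first.
    by apply: ub_le_sup; [exists B => _ [c _ <-]|exists x].
  have := close x; rewrite mdistxx => /(_ (r0 n)).
  rewrite ltr_norml => /andP[H1 H2].
  rewrite /h mdistxx mulr0 subr0 le_min; apply/andP; split; first by lra.
  have := ler_norm (f x); have := fB x.
  lra.
have hi : sup (range (fun c => h n c x)) <= f x + e.
  apply: ge_sup; first by exists (h n x x), x.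
  move=> _ [c _ <-]; rewrite /h ge_min; apply/orP.
  have [/close|rxc] := ltP (mdist x c) (r n).
    by rewrite ltr_norml => /andP[H1 H2]; left; lra.
  right; have : 2 * B <= L n * mdist x c.
    by rewrite /L mulrAC ler_pdivlMr// ler_pM2l// mulr_gt0.
  have := lerNnormlW (fB x); lra.
rewrite ltr_norml; apply/andP; split; move: Neps => /=; lra.
Unshelve. all: by end_near. Qed.

End Baire1.

(** * Transfer along homeomorphisms, and the shadow topology *)

Lemma fragmented_comp (R : realType) (S T : topologicalType) (k : S -> T)
    (f : T -> R) :
  continuous k -> fragmented f -> fragmented (f \o k).
Proof.
move=> ck frag A eps [a Aa] eps0.
have [|O [oO [_ [[b Ab <-] Ob]] osc]] := frag (k @` A) eps _ eps0.
  by exists (k a), a.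
exists (k @^-1` O); split; [|by exists b|].
  by apply: open_comp => // x _; exact: ck.
by move=> x y [Ax Ox] [Ay Oy]; apply: osc; split => //; exact: imageP.
Qed.

Lemma polish_fragmented_Baire1 (R : realType) (T : topologicalType)
    (f : T -> R) :
  polish R T -> bounded_fun f -> fragmented f -> Baire1 f.
Proof.
move=> [M [_ _ [h [k [hK kK ch ck]]]]] [N [Nr NP]] frag.
have bfk : bounded_fun (f \o k) by exists N; split => // x /NP H y _; exact: H.
have [g [cg gf]] := fragmented_Baire1 bfk (fragmented_comp ck frag).
exists (fun n => g n \o h); split => [n x|x].
  by apply: continuous_comp; [exact: ch|exact: cg].
by have := gf (h x); rewrite /= hK.
Qed.

Lemma hausdorff_shadow (X : medianPretreeType) : hausdorff_space (shadow X).
Proof.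
move=> u v uv; apply: contrapT.
move=> /convex_open_separation[C [D [[oC _ Cu] [oD _ Dv CD]]]].
have := uv C D (open_nbhs_nbhs (conj oC Cu)) (open_nbhs_nbhs (conj oD Dv)).
by rewrite CD => -[].
Qed.

Theorem theoremA (R : realType) (X : medianPretreeType) :
  (compact [set: shadow X] \/ polish R (shadow X) ->
    forall f : X -> R, has_bounded_variation f ->
      point_of_continuity_property (f : shadow X -> R)) /\
  (polish R (shadow X) ->
    forall f : X -> R, has_bounded_variation f -> Baire1 (f : shadow X -> R)).
Proof.
have frag (f : X -> R) : has_bounded_variation f ->
    fragmented (f : shadow X -> R).
  by move=> bv A eps; exact: bv_fragmented bv.
split=> [[cX|pX] f bv|pX f bv].
- exact/compact_fragmented_pcp/frag/bv/cX/hausdorff_shadow.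
- exact/polish_fragmented_pcp/frag/bv/pX.
- by apply: polish_fragmented_Baire1 pX _ (frag _ bv); have [] := bv.
Qed.
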